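(* Let $n$ be a positive integer, let $1\le s_1<s_2<\cdots<s_k\le n/2$ be integers, and let $G=\operatorname{Circ}_n(s_1,\dots,s_k)$, which is $k'$-regular where $k'=2k-1$ if $n$ is even and $s_k=n/2$, and $k'=2k$ otherwise. Then the eigenvectors of the $2$-Laplacian $L^{(2)}_G$ are \[ \mathbf{v}_j=(1,\omega^j,\omega^{2j},\dots,\omega^{(n-1)j})^T,\qquad 0\le j\le n-1, \] where $\omega=\exp(2\pi i/n)$, and the corresponding eigenvalues are \[ \frac{1}{12}\left\{\lambda_j^2-16\lambda_j-(k')^2+16k'\right\}, \] where \[ \lambda_j=\begin{cases}(-1)^j+\sum_{i=1}^{k-1}2\cos\frac{2\pi s_i j}{n} & \text{if $n$ is even and } s_k=\frac n2,\\ \sum_{i=1}^{k}2\cos\frac{2\pi s_i j}{n} & \text{otherwise}\end{cases} \] (these $\lambda_j$ are the eigenvalues of the adjacency matrix of $G$ associated with $\mathbf{v}_j$).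
   Context: The circulant graph $\operatorname{Circ}_n(s_1,\dots,s_k)$ has vertices $0,1,\dots,n-1$, and vertex $i$ is adjacent to the vertices $i\pm s_j \pmod n$ for all $1\le j\le k$. For a simple graph $G$ with adjacency matrix $A_G$ and degree matrix $D_G$ (diagonal matrix of vertex degrees), let $A'=\frac{1}{12}\left(16A_G-A_G^2+D_G\right)$ and let $D'$ be the diagonal matrix whose $(i,i)$ entry is the sum of the entries of the $i$th row of $A'$. The $2$-Laplacian of $G$ is $L^{(2)}_G=D'-A'$. *)

(* Defs.v *)
From HB Require Import structures.
From mathcomp Require Import all_boot all_order all_algebra.
From mathcomp Require Import complex.
From mathcomp Require Import reals sequences exp trigo.

Set Implicit Arguments.
Unset Strict Implicit.
Unset Printing Implicit Defensive.

Import Order.TTheory GRing.Theory Num.Theory.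

Local Open Scope ring_scope.
Local Open Scope complex_scope.

Section Graph.
Variables (F : fieldType) (n : nat) (e : rel 'I_n).

Definition degree (i : 'I_n) : nat := #|[pred j | e i j]|.

Definition adjmx : 'M[F]_n := \matrix_(i, j) (e i j)%:R.

Definition degmx : 'M[F]_n := diag_mx (\row_i (degree i)%:R).

Definition adjmx2 : 'M[F]_n :=
  12%:R^-1 *: (16%:R *: adjmx - adjmx *m adjmx + degmx).

Definition laplacian2 : 'M[F]_n :=
  diag_mx (\row_i \sum_j adjmx2 i j) - adjmx2.

End Graph.

(* The disjuncts are j = i + x and j = i - x modulo n. *)
Definition circ (n : nat) (s : seq nat) : rel 'I_n :=
  [rel i j : 'I_n |
     has (fun x => (j == i + x %[mod n])%N || (j + x == i %[mod n])%N) s].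
Arguments circ n s : clear implicits.

(* Under the bounds imposed on the offsets, [circ] is a simple graph. *)
Lemma circ_sym (n : nat) (s : seq nat) : symmetric (circ n s).
Proof.
move=> i j; rewrite /circ /=; apply: eq_has => x.
by rewrite orbC eq_sym [X in _ || X]eq_sym.
Qed.

Lemma circ_irr (n : nat) (s : seq nat) :
  all (fun x => 1 <= x <= n./2)%N s -> irreflexive (circ n s).
Proof.
move=> /allP hs i; apply/hasPn => x /hs /andP[x0 xn].
have n0 : (0 < n)%N by apply: leq_ltn_trans (ltn_ord i).
have ltxn : (x < n)%N.
  by rewrite (leq_ltn_trans xn) // -divn2 ltn_Pdiv.
have neq : (i + x == i %[mod n])%N = false.
  by rewrite -[X in _ == X %[mod n]]addn0 eqn_modDl mod0n modn_small // gtn_eqF.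
by rewrite /= [X in X || _]eq_sym neq.
Qed.

Section Spectrum.
Variable R : realType.

Definition cexp (z : R[i]) : R[i] :=
  (expR (complex.Re z))%:C * (cos (complex.Im z) +i* sin (complex.Im z)).

Definition omega (n : nat) : R[i] := cexp (2%:R * pi%:C * 'i / n%:R).

Definition fourier_vec (n : nat) (j : 'I_n) : 'cV[R[i]]_n :=
  \col_(m < n) omega n ^+ (m * j).

(* For [s = [:: s_1; ...; s_k]] and [n > 0]: whether [n] is even and
   [s_k = n / 2]. *)
Definition has_antipode (n : nat) (s : seq nat) : bool :=
  ~~ odd n && (last 0%N s == n./2).

Definition circ_degree (n k : nat) (s : k.-tuple nat) : nat :=
  if has_antipode n s then (2 * k - 1)%N else (2 * k)%N.

Definition circ_eigenval (n k : nat) (s : k.-tuple nat) (j : nat) : R :=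
  if has_antipode n s
  then (-1) ^+ j
       + \sum_(i < k.-1) 2%:R * cos (2%:R * pi * (nth 0%N s i)%:R * j%:R / n%:R)
  else \sum_(i < k) 2%:R * cos (2%:R * pi * (nth 0%N s i)%:R * j%:R / n%:R).

Definition circ_eigenval2 (n k : nat) (s : k.-tuple nat) (j : nat) : R :=
  12%:R^-1 * (circ_eigenval n s j ^+ 2 - 16%:R * circ_eigenval n s j
              - (circ_degree n s)%:R ^+ 2 + 16%:R * (circ_degree n s)%:R).

End Spectrum.

Definition is_eigenvector (F : fieldType) (n : nat) (M : 'M[F]_n)
    (v : 'cV[F]_n) (a : F) : Prop :=
  v != 0 /\ M *m v = a *: v.

(* Main.v *)
(* The neighbours of i in the circulant graph are the i + t mod n, for t ranging
   over the duplicate-free list of the s_r and the n - s_r (with n / 2 listed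
   once).  For an n-th root of unity w = omega ^ j, summing w ^ (i + t) over
   these t factors out w ^ i, and the conjugate pairs w ^ x + w ^ (n - x) add up
   to cosines: v_j is an eigenvector of A for lambda_j.  As G is k'-regular,
   the 2-Laplacian is a polynomial in A plus a scalar matrix, whose scalar is
   found by applying A' to the all-ones vector.  The v_j form a Vandermonde
   matrix with distinct nodes, hence a basis, and diagonalizing in that basis
   gives the characteristic polynomial. *)

Require Import Defs.
From mathcomp Require Import all_boot all_order all_algebra.
From mathcomp Require Import complex.
From mathcomp Require Import reals sequences exp trigo.
From mathcomp Require Import zify ring lra.

Set Implicit Arguments.
Unset Strict Implicit.
Unset Printing Implicit Defensive.

Import Order.TTheory GRing.Theory Num.Theory.

Local Open Scope ring_scope.
Local Open Scope complex_scope.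

(** * Neighbours in a circulant graph and sums over them *)

(* Each offset x contributes x and n - x, except that x = n / 2 is its own
   opposite and must be listed once. *)
Lemma circ_has (n : nat) (s : seq nat) (i j : 'I_n) :
  (0 < n)%N -> all (fun x => 1 <= x <= n./2)%N s ->
  circ n s i j =
  has (fun t => j == i + t %[mod n])%N
      (s ++ [seq (n - x)%N | x <- s & x.*2 != n]).
Proof.
move=> n_gt0 /allP hs.
have opp x : x \in s -> (j + x == i %[mod n])%N = (j == i + (n - x) %[mod n])%N.
  move=> /hs /andP[_ xn]; rewrite -[RHS](eqn_modDr x) -addnA subnK; last by lia.
  by rewrite modnDr.
rewrite has_cat; apply/hasP/orP => [[x xs /orP[ij|]]|[]/hasP[t]].
- by left; apply/hasP; exists x.
- rewrite opp // => ij; have [x2n|x2n] := eqVneq x.*2 n.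
    (* Here [x = n / 2] equals [n - x], so the offset already listed in [s] serves. *)
    by left; apply/hasP; exists x => //; rewrite (_ : x = n - x)%N //; lia.
  by right; apply/hasP; exists (n - x)%N => //; rewrite map_f // mem_filter x2n.
- by move=> ts ij; exists t; rewrite //= ij.
- case/mapP => x; rewrite mem_filter => /andP[_ xs] -> ij.
  by exists x => //; rewrite /= opp // ij orbT.
Qed.

Lemma uniq_circ_offsets (n : nat) (s : seq nat) :
  sorted ltn s -> all (fun x => 1 <= x <= n./2)%N s ->
  uniq (s ++ [seq (n - x)%N | x <- s & x.*2 != n]).
Proof.
move=> s_sorted /allP hs.
have s_uniq : uniq s by apply: sorted_uniq ltn_trans ltnn _ s_sorted.
rewrite cat_uniq s_uniq map_inj_in_uniq ?filter_uniq ?andbT //=.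
  (* If [n - x] were in [s], then [x] and [n - x] would both be at most [n / 2], forcing [2 x = n],
     which the filter excludes. *)
  apply/hasPn => t /mapP[x]; rewrite mem_filter => /andP[x2n xs] ->.
  by apply/negP => /hs; have := hs _ xs; move/eqP: x2n; lia.
by move=> x y; rewrite !mem_filter => /andP[_ /hs xs] /andP[_ /hs ys]; lia.
Qed.

(** At each index at most one of the predicates holds, so splitting off the head of [s] counts
    nothing twice. *)
Lemma big_has_disjoint (V : nmodType) (I : finType) (T : eqType) (s : seq T)
    (P : T -> pred I) (F : I -> V) :
  uniq s ->
  (forall x y i, x \in s -> y \in s -> P x i -> P y i -> x = y) ->
  \sum_(i | has (fun x => P x i) s) F i = \sum_(x <- s) \sum_(i | P x i) F i.
Proof.
elim: s => [|x s IHs] /=; first by rewrite big_nil big_pred0.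
move=> /andP[xs s_uniq] Pdisj; rewrite big_cons -IHs //; last first.
  by move=> y z i ys zs; apply: Pdisj; rewrite inE ?ys ?zs orbT.
rewrite (bigID (P x)) /=; congr (_ + _); apply: eq_bigl => i.
  by rewrite andbC andb_orr andbb orbC; case: (P x i); rewrite ?orbT ?andbF.
case: (boolP (P x i)) => Pxi; rewrite ?andbF ?andbT //=.
apply/esym/hasPn => y ys; apply/negP => Pyi; move: xs.
by rewrite (Pdisj x y i) ?ys // inE ?eqxx ?ys ?orbT.
Qed.

Lemma sum_eqmod (V : nmodType) (n m : nat) (F : nat -> V) :
  (0 < n)%N -> (forall m, F (m %% n)%N = F m) ->
  \sum_(j < n | (j == m %[mod n])%N) F j = F m.
Proof.
move=> n_gt0 Fmod; rewrite (big_pred1 (Ordinal (ltn_pmod m n_gt0))) ?Fmod //=.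
by move=> j; rewrite [in LHS]modn_small.
Qed.

Lemma sum_circ (V : nmodType) (n : nat) (s : seq nat) (i : 'I_n)
    (F : nat -> V) :
  (0 < n)%N -> sorted ltn s -> all (fun x => 1 <= x <= n./2)%N s ->
  (forall m, F (m %% n)%N = F m) ->
  \sum_(j < n | circ n s i j) F j =
  \sum_(x <- s) F (i + x)%N + \sum_(x <- s | x.*2 != n) F (i + (n - x))%N.
Proof.
move=> n_gt0 s_sorted hs Fmod.
under eq_bigl => j do rewrite circ_has //.
rewrite big_has_disjoint ?uniq_circ_offsets //; last first.
  (* All offsets are below [n], so two of them congruent modulo [n] coincide. *)
  have small t : t \in s ++ [seq (n - x)%N | x <- s & x.*2 != n] -> (t < n)%N.
    rewrite mem_cat => /orP[/(allP hs)|/mapP[x]]; first by lia.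
    by rewrite mem_filter => /andP[_ /(allP hs)]; lia.
  move=> x y j /small xn /small yn /eqP -> /eqP /eqP.
  by rewrite eqn_modDl !modn_small // => /eqP.
under eq_bigr => x _ do rewrite sum_eqmod //.
by rewrite big_cat /= big_map big_filter.
Qed.

(** A strictly increasing [s] bounded by [n / 2] can contain [n / 2] only as its last entry, so the
    filter drops at most one term of [G]; every other offset pairs [F] with [G]. *)
Lemma sum_offsets (V : nmodType) (n : nat) (s : seq nat) (F G : nat -> V) :
  (0 < n)%N -> sorted ltn s -> all (fun x => 1 <= x <= n./2)%N s ->
  \sum_(x <- s) F x + \sum_(x <- s | x.*2 != n) G x =
  if has_antipode n s
  then F n./2 + \sum_(r < (size s).-1) (F (nth 0 s r)%N + G (nth 0 s r)%N)
  else \sum_(r < size s) (F (nth 0 s r)%N + G (nth 0 s r)%N).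
Proof.
move=> n_gt0 + /allP hs.
have sumE u : {in u, forall x, x.*2 != n} ->
    \sum_(x <- u) F x + \sum_(x <- u | x.*2 != n) G x =
    \sum_(r < size u) (F (nth 0 u r)%N + G (nth 0 u r)%N).
  move=> /allP/all_filterP hu; rewrite -[X in _ + X]big_filter hu.
  by rewrite -big_split /= (big_nth 0%N) big_mkord.
case/lastP: s hs => [|u z] hs.
  rewrite !big_nil addr0 => _; case: ifP; last by rewrite big_ord0.
  by rewrite /has_antipode /=; lia.
rewrite (sorted_pairwise ltn_trans) pairwise_rcons => /andP[/allP uz _].
rewrite /has_antipode last_rcons.
case: ifP => [/andP[n_even /eqP zn]|no_antipode].
  have ux x : x \in u -> x.*2 != n by move=> /uz; lia.
  rewrite -!cats1 !big_cat big_seq1 big_cons big_nil /= zn.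
  have -> : (n./2.*2 != n) = false by lia.
  rewrite addr0 size_cat addn1 /= addrAC addrC sumE //; congr (_ + _).
  by apply: eq_bigr => r _; rewrite nth_cat ltn_ord.
(* Entries of [u] lie strictly below [z], itself at most [n / 2], so only [z] could double to [n];
   [no_antipode] rules this out. *)
apply: sumE => x xs; have := hs _ xs; have := hs z; rewrite mem_rcons mem_head.
move: xs no_antipode; rewrite mem_rcons inE => /predU1P[->|/uz]; lia.
Qed.

(** * The 2-Laplacian of a regular graph, and characteristic polynomials from eigenbases *)

Lemma adjmx_mul (F : fieldType) (n : nat) (e : rel 'I_n) (v : 'cV[F]_n)
    (i : 'I_n) :
  (adjmx F e *m v) i 0 = \sum_(j | e i j) v j 0.
Proof.
rewrite mxE [RHS]big_mkcond; apply: eq_bigr => j _.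
by rewrite mxE; case: (e i j); rewrite ?mul1r ?mul0r.
Qed.

Lemma degmx_regular (F : fieldType) (n d : nat) (e : rel 'I_n) :
  (forall i, degree e i = d) -> degmx F e = d%:R%:M.
Proof.
move=> e_reg; rewrite -diag_const_mx /degmx; congr diag_mx.
by apply/rowP => i; rewrite !mxE e_reg.
Qed.

(** Regularity makes the degree matrix scalar, so [adjmx2] is a polynomial in the adjacency matrix
    and keeps its eigenvectors. *)
Lemma adjmx2_eigen (F : fieldType) (n d : nat) (e : rel 'I_n) (v : 'cV[F]_n)
    (a : F) :
  (forall i, degree e i = d) -> adjmx F e *m v = a *: v ->
  adjmx2 F e *m v = (12%:R^-1 * (16%:R * a - a ^+ 2 + d%:R)) *: v.
Proof.
move=> e_reg av; rewrite /adjmx2 (degmx_regular _ e_reg) -scalemxAl -scalerA.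
congr (_ *: _); rewrite mulmxDl mulmxBl -scalemxAl -mulmxA mul_scalar_mx av.
by rewrite -scalemxAr av !scalerA -scalerBl -scalerDl expr2.
Qed.

Lemma laplacian2_eigen (F : fieldType) (n d : nat) (e : rel 'I_n)
    (v : 'cV[F]_n) (a : F) :
  (forall i, degree e i = d) -> adjmx F e *m v = a *: v ->
  laplacian2 F e *m v =
  (12%:R^-1 * (a ^+ 2 - 16%:R * a - d%:R ^+ 2 + 16%:R * d%:R)) *: v.
Proof.
move=> e_reg av; pose u : 'cV[F]_n := const_mx 1.
have au : adjmx F e *m u = d%:R *: u.
  apply/colP => i; rewrite adjmx_mul !mxE mulr1 -(e_reg i) /degree.
  by rewrite -sum1_card natr_sum; apply: eq_bigr => j _; rewrite mxE.
have row_sum i : \sum_j adjmx2 F e i j =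
    12%:R^-1 * (16%:R * d%:R - d%:R ^+ 2 + d%:R).
  transitivity ((adjmx2 F e *m u) i 0); last first.
    by rewrite (adjmx2_eigen e_reg au) !mxE mulr1.
  by rewrite [RHS]mxE; apply: eq_bigr => j _; rewrite [u _ _]mxE mulr1.
rewrite /laplacian2.
have -> : \row_i \sum_j adjmx2 F e i j =
    const_mx (12%:R^-1 * (16%:R * d%:R - d%:R ^+ 2 + d%:R)).
  by apply/rowP => i; rewrite !mxE row_sum.
(* The [d%:R] contributed by the degree matrix cancels between the row sum and the eigenvalue of
   [adjmx2]. *)
rewrite diag_const_mx mulmxBl (adjmx2_eigen e_reg av).
by rewrite mul_scalar_mx -scalerBl; congr (_ *: _); ring.
Qed.

(** With [D] the diagonal matrix of eigenvalues, [M V = V D] gives [(X - M) V = V (X - D)]; after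
    taking determinants, the nonzero constant [det V] cancels. *)
Lemma char_poly_eigenbasis (F : fieldType) (n : nat) (M V : 'M[F]_n)
    (a : 'I_n -> F) :
  V \in unitmx -> (forall j, M *m col j V = a j *: col j V) ->
  char_poly M = \prod_j ('X - (a j)%:P).
Proof.
move=> V_unit MV; pose D := diag_mx (\row_j a j).
have MVD : M *m V = V *m D.
  apply/matrixP => i j.
  have /(congr1 (fun w : 'cV_n => w i 0)) := MV j; rewrite mul_mx_diag !mxE.
  by move=> MVi; rewrite mulrC -MVi; apply: eq_bigr => k _; rewrite mxE.
have -> : \prod_j ('X - (a j)%:P) = char_poly D.
  rewrite char_poly_trig ?diag_mx_is_trig //.
  by apply: eq_bigr => j _; rewrite !mxE eqxx.
have : char_poly_mx M *m map_mx polyC V = map_mx polyC V *m char_poly_mx D.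
  rewrite mulmxBl mulmxBr -!map_mxM MVD; congr (_ - _).
  by rewrite mul_scalar_mx mul_mx_scalar.
move=> /(congr1 determinant); rewrite !det_mulmx mulrC => /mulfI; apply.
by rewrite det_map_mx polyC_eq0 -unitfE -unitmxE.
Qed.

(** * Powers of the root of unity and the Fourier basis *)

Section RootsOfUnity.
Variable R : realType.
Implicit Types (x y : R) (n m : nat).

Definition cis x : R[i] := cos x +i* sin x.

Lemma cisD x y : cis (x + y) = cis x * cis y.
Proof. by rewrite /cis cosD sinD [X in _ +i* X]addrC. Qed.

Lemma cisX x m : cis x ^+ m = cis (x *+ m).
Proof.
elim: m => [|m IHm]; first by rewrite mulr0n /cis cos0 sin0.
by rewrite exprS mulrS cisD IHm.
Qed.

Lemma omegaE n : omega R n = cis (2%:R * pi / n%:R).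
Proof.
rewrite /omega.
have -> : 2%:R * pi%:C * 'i / n%:R = 0 +i* (2%:R * pi / n%:R) :> R[i].
  rewrite -[n%:R](rmorph_nat (real_complex R)) -fmorphV /=.
  rewrite -[2%:R in LHS](rmorph_nat (real_complex R)) -rmorphM /=.
  rewrite mulrAC -rmorphM /=.
  by apply/eqP; rewrite eq_complex /= !mulr0 !mulr1 ?subr0 ?addr0 !eqxx.
by rewrite /cexp /= expR0 mul1r.
Qed.

Lemma omegaX n m : omega R n ^+ m = cis (2%:R * pi * m%:R / n%:R).
Proof. by rewrite omegaE cisX; congr cis; ring. Qed.

Lemma omega_n n : (0 < n)%N -> omega R n ^+ n = 1.
Proof.
move=> n_gt0; rewrite omegaX mulfK ?pnatr_eq0 -?lt0n //.
by rewrite mulrC mulr_natr /cis cos2pi sin2pi.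
Qed.

Lemma omega_half n : (0 < n)%N -> ~~ odd n -> omega R n ^+ n./2 = -1.
Proof.
move=> n_gt0 n_even; rewrite omegaX.
have -> : 2%:R * pi * n./2%:R / n%:R = pi :> R.
  have -> : 2%:R * pi * n./2%:R = pi * n%:R :> R.
    by rewrite mulrAC mulrC -natrM mul2n even_halfK.
  by rewrite mulfK // pnatr_eq0 -lt0n.
by rewrite /cis cospi sinpi; apply/eqP; rewrite eq_complex /= oppr0 !eqxx.
Qed.

(** With [t = pi m / n] strictly between 0 and pi, the real part of the power is
    [cos (2 t) = 1 - 2 sin^2 t], which is less than 1. *)
Lemma omega_neq1 n m : (0 < m < n)%N -> omega R n ^+ m != 1.
Proof.
move=> /andP[m_gt0 mn]; have n_gt0 := ltn_trans m_gt0 mn.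
pose t : R := pi * (m%:R / n%:R).
have t_bounds : 0 < t < pi.
  rewrite mulr_gt0 ?pi_gt0 ?divr_gt0 ?ltr0n //= gtr_pMr ?pi_gt0 //.
  by rewrite ltr_pdivrMr ?ltr0n // mul1r ltr_nat.
rewrite omegaX (_ : _ / _ = t *+ 2); last by rewrite /t; ring.
rewrite eq_complex /= cos_mulr2n cos2sin2 negb_and.
have sin_gt0 := sin_gt0_pi t_bounds.
by apply/orP; left; apply/eqP; nra.
Qed.

Lemma omega_neq0 n : (0 < n)%N -> omega R n != 0.
Proof.
move=> n_gt0; apply/eqP => omega0; have := omega_n n_gt0.
by rewrite omega0 expr0n gtn_eqF // => /esym/eqP; rewrite oner_eq0.
Qed.

Lemma omegaX_mod n j m :
  (0 < n)%N -> (omega R n ^+ j) ^+ (m %% n) = (omega R n ^+ j) ^+ m.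
Proof.
by move=> n_gt0; rewrite expr_mod // -exprM mulnC exprM omega_n // expr1n.
Qed.

Lemma omegaX_add_opp n j m : (0 < n)%N -> (m <= n)%N ->
  (omega R n ^+ j) ^+ m + (omega R n ^+ j) ^+ (n - m) =
  (2%:R * cos (2%:R * pi * m%:R * j%:R / n%:R))%:C.
Proof.
move=> n_gt0 mn; set t := _ / n%:R.
have omega_t : (omega R n ^+ j) ^+ m = cis t.
  by rewrite -exprM omegaX natrM; congr cis; rewrite /t; ring.
have -> : (omega R n ^+ j) ^+ (n - m) = cis (- t).
  (* Multiplying by [cis t * cis (- t) = 1] restores the full exponent [n], so no inverse has to be
     taken. *)
  have t_opp : cis t * cis (- t) = 1 by rewrite -cisD subrr /cis cos0 sin0.
  rewrite -[LHS]mulr1 -t_opp -omega_t mulrA -exprD subnK // -exprM mulnC exprM.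
  by rewrite omega_n // expr1n mul1r.
rewrite omega_t /cis cosN sinN.
by apply/eqP; rewrite eq_complex /= subrr eqxx andbT; apply/eqP; ring.
Qed.

Lemma fourier_vec_neq0 n (j : 'I_n) : fourier_vec R j != 0.
Proof.
have n_gt0 : (0 < n)%N by apply: leq_ltn_trans (ltn_ord j).
apply/eqP => /colP/(_ (Ordinal n_gt0))/eqP.
by rewrite !mxE mul0n expr0 oner_eq0.
Qed.

(** The matrix is Vandermonde with nodes [omega R n ^+ j]; two equal nodes would make the power of
    exponent [j - i] equal to 1, with [0 < j - i < n]. *)
Lemma fourier_unitmx n :
  (\matrix_(m < n, j < n) fourier_vec R j m ord0) \in unitmx.
Proof.
have -> : \matrix_(m < n, j < n) fourier_vec R j m ord0 =
    Vandermonde n (\row_j omega R n ^+ j).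
  by apply/matrixP => m j; rewrite !mxE mulnC exprM.
rewrite unitmxE det_Vandermonde unitfE.
apply/prodf_neq0 => i _; apply/prodf_neq0 => j ij; rewrite !mxE subr_eq0.
have n_gt0 := leq_ltn_trans (leq0n i) (ltn_ord i).
have : omega R n ^+ (j - i) != 1.
  by apply: omega_neq1; rewrite subn_gt0 ij (leq_ltn_trans (leq_subr _ _)).
apply: contraNneq => eq_ij; rewrite expfB_cond ?(negPf (omega_neq0 _)) //.
  by rewrite eq_ij divff // expf_neq0 // omega_neq0.
by rewrite ltnW.
Qed.

End RootsOfUnity.

(** * Degree and spectrum of the circulant graph *)

(** For empty [s], [last] returns 0, which is not half of a positive even [n]. This keeps the
    truncated [2 * k - 1] and [k.-1] consistent. *)
Lemma has_antipode_gt0 (n k : nat) (s : k.-tuple nat) :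
  (0 < n)%N -> has_antipode n s -> (0 < k)%N.
Proof.
move=> n_gt0; case: k s => // s; rewrite tuple0 /has_antipode /=; lia.
Qed.

(** Taken with [F] constantly 1 it yields the degree; with [F] the powers of [omega R n ^+ j], the
    adjacency eigenvalue. *)
Lemma sum_circ_tuple (V : nmodType) (n k : nat) (s : k.-tuple nat) (i : 'I_n)
    (F : nat -> V) :
  (0 < n)%N -> sorted ltn s -> all (fun x => 1 <= x <= n./2)%N s ->
  (forall m, F (m %% n)%N = F m) ->
  \sum_(j < n | circ n s i j) F j =
  if has_antipode n s
  then F (i + n./2)%N
       + \sum_(r < k.-1) (F (i + nth 0 s r)%N + F (i + (n - nth 0 s r))%N)
  else \sum_(r < k) (F (i + nth 0 s r)%N + F (i + (n - nth 0 s r))%N).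
Proof.
move=> n_gt0 s_sorted hs Fmod; rewrite sum_circ //.
rewrite (sum_offsets (fun x => F (i + x)%N) (fun x => F (i + (n - x))%N)) //.
by rewrite size_tuple.
Qed.

Lemma degree_circ (n k : nat) (s : k.-tuple nat) (i : 'I_n) :
  (0 < n)%N -> sorted ltn s -> all (fun x => 1 <= x <= n./2)%N s ->
  degree (circ n s) i = circ_degree n s.
Proof.
move=> n_gt0 s_sorted hs; rewrite /degree -sum1_card.
rewrite (sum_circ_tuple _ (F := fun=> 1%N)) // /circ_degree.
case: ifP => [/(has_antipode_gt0 n_gt0)|_]; rewrite sum_nat_const card_ord; lia.
Qed.

Lemma adjmx_circ_eigen (R : realType) (n k : nat) (s : k.-tuple nat)
    (j : 'I_n) :
  (0 < n)%N -> sorted ltn s -> all (fun x => 1 <= x <= n./2)%N s ->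
  adjmx R[i] (circ n s) *m fourier_vec R j =
  (circ_eigenval R n s j)%:C *: fourier_vec R j.
Proof.
move=> n_gt0 s_sorted hs; pose w : R[i] := omega R n ^+ j.
have wE m : omega R n ^+ (m * j) = w ^+ m by rewrite mulnC exprM.
apply/colP => i; rewrite adjmx_mul !mxE wE.
under eq_bigr => m _ do rewrite mxE wE.
rewrite (sum_circ_tuple _ (F := fun m => w ^+ m)) //; last first.
  by move=> m; rewrite omegaX_mod.
have term x : (x <= n)%N -> w ^+ (i + x) + w ^+ (i + (n - x)) =
    (2%:R * cos (2%:R * pi * x%:R * j%:R / n%:R))%:C * w ^+ i.
  by move=> xn; rewrite !exprD -mulrDr mulrC omegaX_add_opp.
(* Past the end of [s] the default value 0 of [nth] satisfies the bound, so [r] can be arbitrary. *)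
have nth_le r : (nth 0 s r <= n)%N.
  have [rs|rs] := ltnP r (size s); last by rewrite nth_default.
  have /andP[_ /leq_trans] := allP hs _ (mem_nth 0%N rs); apply; lia.
rewrite /circ_eigenval; case: ifP => [/andP[n_even _]|_].
  rewrite rmorphD rmorph_sum mulrDl mulr_suml; congr (_ + _).
    (* The antipode contributes the [j]-th power of [omega R n ^+ n./2 = -1]. *)
    rewrite exprD mulrC -[w ^+ n./2]wE exprM omega_half //.
    by rewrite rmorphXn rmorphN1.
  by apply: eq_bigr => r _; rewrite term.
by rewrite rmorph_sum mulr_suml; apply: eq_bigr => r _; rewrite term.
Qed.

Theorem theorem6p12 (R : realType) (n k : nat) (s : k.-tuple nat)
    (n_gt0 : (0 < n)%N)
    (s_incr : sorted ltn s)
    (s_bound : all (fun x => 1 <= x <= n./2)%N s) :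
  [/\ (* G is k'-regular *)
      (forall i : 'I_n, degree (circ n s) i = circ_degree n s),
      (* lambda_j is the eigenvalue of the adjacency matrix at v_j *)
      (forall j : 'I_n,
         is_eigenvector (adjmx R[i] (circ n s))
           (fourier_vec R j) (circ_eigenval R n s j)%:C),
      (* each v_j is an eigenvector of the 2-Laplacian *)
      (forall j : 'I_n,
         is_eigenvector (laplacian2 R[i] (circ n s))
           (fourier_vec R j) (circ_eigenval2 R n s j)%:C),
      (* the v_j form a basis of C^n *)
      (\matrix_(m < n, j < n) fourier_vec R j m ord0) \in unitmx
    & (* the eigenvalues, with multiplicity *)
      char_poly (laplacian2 R[i] (circ n s))
        = \prod_(j < n) ('X - ((circ_eigenval2 R n s j)%:C)%:P)].
Proof.
have deg i := degree_circ i n_gt0 s_incr s_bound.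
have adj (j : 'I_n) := adjmx_circ_eigen R j n_gt0 s_incr s_bound.
have lap (j : 'I_n) : laplacian2 R[i] (circ n s) *m fourier_vec R j =
    (circ_eigenval2 R n s j)%:C *: fourier_vec R j.
  rewrite (laplacian2_eigen deg (adj j)) /circ_eigenval2; congr (_ *: _).
  by rewrite !(rmorphM, rmorphD, rmorphN, rmorphXn, rmorph_nat, fmorphV).
split=> //.
- by move=> j; split; [exact: fourier_vec_neq0 | exact: adj].
- by move=> j; split; [exact: fourier_vec_neq0 | exact: lap].
- exact: fourier_unitmx.
apply: char_poly_eigenbasis (fourier_unitmx R n) _ => j.
have -> : col j (\matrix_(m < n, j < n) fourier_vec R j m ord0) =
    fourier_vec R j by apply/colP => m; rewrite !mxE.
exact: lap.
Qed.
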